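(* The join-irreducible elements of the Schröder lattice $\mathcal{S}_n$ are exactly the paths of the form $$(HH)^{i}\,U^{j-i}D^{j-i}\,(HH)^{n-j}\quad(0\le i,\ i+1\le j\le n)$$ or $$(HH)^{i}\,U^{j-i-1}\,HH\,D^{j-i-1}\,(HH)^{n-j}\quad(0\le i,\ i+2\le j\le n).$$ In particular, $$\mathbf{Spec}(\mathcal{S}_n)\simeq\{(i,j,k)\in\mathcal{C}_n^2\times\mathcal{C}_1 : 2j-2i\ge 2+2k\}.$$
   Context: A Schröder path of length $2n$ is a lattice path from $(0,0)$ to $(2n,0)$, never going below the $x$-axis, with steps $U=(1,1)$, $D=(1,-1)$ and double horizontal steps $HH=(2,0)$. The Schröder lattice $\mathcal{S}_n$ is the set of all Schröder paths of length $2n$, ordered by $x\le y$ iff $x$ lies weakly below $y$. It is a finite distributive lattice with minimum $\widehat0=(HH)^n$. A join-irreducible element is an $x\ne\widehat0$ such that $x=u\vee v$ implies $x=u$ or $x=v$; $\mathbf{Spec}$ denotes the set of join-irreducibles with the induced order. $\mathcal{C}_m$ is the chain $\{0<1<\cdots<m\}$. In a triple $(i,j,k)$, the pair $(i,j)$ records that the nonflat part of the path lies over $[2i,2j]$, with $k=0$ for the first form (peak) and $k=1$ for the second form (truncated pyramid). Triples are ordered by: $(i,j,k)\le(i',j',k')$ iff either $[i,j]\subsetneq[i',j']$, or $(i,j)=(i',j')$ and $k\ge k'$. *)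

(* Defs.v *)
From HB Require Import structures.
From mathcomp Require Import all_boot all_order all_algebra.
From mathcomp Require Import zify.

Set Implicit Arguments.
Unset Strict Implicit.
Unset Printing Implicit Defensive.

Import Order.TTheory GRing.Theory Num.Theory.

Section Spec.
Context {d : Order.disp_t} {L : finTBLatticeType d}.
Local Open Scope order_scope.

Definition join_irreducible (x : L) : bool :=
  (x != \bot) &&
  [forall u : L, forall v : L, (x == u `|` v) ==> (x == u) || (x == v)].

End Spec.

Definition Spec d (L : finTBLatticeType d) : Type :=
  {x : L | join_irreducible x}.

HB.instance Definition _ d (L : finTBLatticeType d) :=
  SubFinite.on (Spec L).
HB.instance Definition _ d (L : finTBLatticeType d) :=
  [SubChoice_isSubPOrder of Spec L by <: with d].

Inductive step := U | D | HH.

Definition nat_of_step s := match s with U => 0 | D => 1 | HH => 2 end.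
Definition step_of_nat k := match k with 0 => U | 1 => D | _ => HH end.
Lemma nat_of_stepK : cancel nat_of_step step_of_nat. Proof. by case. Qed.
HB.instance Definition _ := Countable.copy step (can_type nat_of_stepK).
Lemma step_enumP : Finite.axiom [:: U; D; HH]. Proof. by case. Qed.
HB.instance Definition _ := isFinite.Build step step_enumP.

Section Height.
Local Open Scope ring_scope.

Definition step_slopes (s : step) : seq int :=
  match s with U => [:: 1] | D => [:: -1] | HH => [:: 0; 0] end.

Definition slopes (w : seq step) : seq int := flatten (map step_slopes w).

(* Height above abscissa t of the path with word w starting at (0,0). The path
   is affine between consecutive integral abscissae, so these heights (which
   include the midpoints of HH steps) determine it. *)
Definition height (w : seq step) (t : nat) : int :=
  \sum_(a <- take t (slopes w)) a.

Definition is_schroder (n : nat) (w : seq step) : bool :=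
  [&& size (slopes w) == n.*2, height w n.*2 == 0
    & [forall t : 'I_(n.*2).+1, 0 <= height w t]].

End Height.

Record schroder (n : nat) := Schroder {
  word :> seq step;
  wordP : is_schroder n word }.

HB.instance Definition _ n := [isSub for @word n].
HB.instance Definition _ n := [Countable of schroder n by <:].

Section HeightTheory.
Local Open Scope ring_scope.

Lemma height0 w : height w 0%N = 0.
Proof. by rewrite /height take0 big_nil. Qed.

Lemma height_nil t : height [::] t = 0.
Proof. by rewrite /height /= big_nil. Qed.

Lemma heightU w t : height (U :: w) t.+1 = 1 + height w t.
Proof. by rewrite /height /= big_cons. Qed.

Lemma heightD w t : height (D :: w) t.+1 = -1 + height w t.
Proof. by rewrite /height /= big_cons. Qed.

Lemma heightH1 w : height (HH :: w) 1%N = 0.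
Proof. by rewrite /height /= big_seq1. Qed.

Lemma heightH w t : height (HH :: w) t.+2 = height w t.
Proof. by rewrite /height /= !big_cons !add0r. Qed.

Lemma height_step w t : `|height w t.+1 - height w t| <= 1.
Proof.
elim: w t => [|[] w IHw] t; first by rewrite !height_nil.
- case: t => [|t]; rewrite !(heightU, height0); first lia.
  by have := IHw t; lia.
- case: t => [|t]; rewrite !(heightD, height0); first lia.
  by have := IHw t; lia.
- case: t => [|[|t]]; rewrite !(heightH, heightH1, height0) //.
Qed.

(* The heights of a Schroder path are the functions h with unit variation such
   that any point (t, h t) with t + h t odd is the midpoint of an HH step. *)
Definition profile (n : nat) (h : nat -> int) : Prop :=
  [/\ h 0%N = 0, h n.*2 = 0,
      forall t, (t <= n.*2)%N -> 0 <= h t,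
      forall t, (t < n.*2)%N -> `|h t.+1 - h t| <= 1
    & forall t, (t <= n.*2)%N -> ((t%:Z + h t) %% 2)%Z = 1 ->
        h t.-1 = h t /\ h t.+1 = h t].

Lemma height_odd w t : (t <= size (slopes w))%N ->
  ((t%:Z + height w t) %% 2)%Z = 1 ->
  [/\ (0 < t)%N, height w t.-1 = height w t & height w t.+1 = height w t].
Proof.
elim: w t => [|[] w IHw] t.
- by case: t => // _; rewrite height_nil.
- case: t => [|t]; rewrite ?height0 // heightU => /= lt_t odd_t.
  have [||] := IHw t; [by [] | lia |].
  by case: t lt_t odd_t => // t _ _ _; rewrite !heightU => /= -> ->.
- case: t => [|t]; rewrite ?height0 // heightD => /= lt_t odd_t.
  have [||] := IHw t; [by [] | lia |].
  by case: t lt_t odd_t => // t _ _ _; rewrite !heightD => /= -> ->.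
- case: t => [|[|t]]; rewrite ?height0 //.
    by rewrite heightH1 heightH !height0.
  rewrite heightH => /= lt_t odd_t.
  have [||] := IHw t; [by [] | lia |].
  by case: t lt_t odd_t => // t _ _ _; rewrite !heightH.
Qed.

Lemma profile_height n (x : schroder n) : profile n (height x).
Proof.
case: x => w /= /and3P[/eqP szw /eqP h2n /forallP h_ge0].
split=> // [|t le_t|t _|t le_t odd_t]; first exact: height0.
- by have := h_ge0 (Ordinal (le_t : (t < (n.*2).+1)%N)).
- exact: height_step.
- by have [||] := @height_odd w t; rewrite ?szw.
Qed.

Fixpoint unslopes (a : seq int) : seq step :=
  if a is x :: a' then
    if x == 1 then U :: unslopes a'
    else if x == -1 then D :: unslopes a'
    else if a' is _ :: a'' then HH :: unslopes a'' else [::]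
  else [::].

Lemma slopesK : cancel slopes unslopes.
Proof. by elim=> // -[] w /= ->. Qed.

Definition increments (h : nat -> int) (m : nat) : seq int :=
  mkseq (fun t => h t.+1 - h t) m.

Lemma slopesE w : slopes w = increments (height w) (size (slopes w)).
Proof.
apply: (@eq_from_nth _ 0) => [|i lti]; first by rewrite size_mkseq.
rewrite nth_mkseq // /height (take_nth 0 lti) -cats1 big_cat big_seq1 /=.
by rewrite [RHS]addrC addKr.
Qed.

Lemma unslopesK (h : nat -> int) N :
    (forall t, (t < N)%N -> `|h t.+1 - h t| <= 1) ->
    (forall t, (t <= N)%N -> ((t%:Z + h t) %% 2)%Z = 1 ->
      h t.-1 = h t /\ h t.+1 = h t) ->
    ((N%:Z + h N) %% 2)%Z = 0 -> ((0%:Z + h 0%N) %% 2)%Z = 0 ->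
  slopes (unslopes (increments h N)) = increments h N.
Proof.
move=> h1 hodd hN h0; rewrite /increments /mkseq.
suff gen k m t : (m < k)%N -> (t + m = N)%N -> ((t%:Z + h t) %% 2)%Z = 0 ->
    slopes (unslopes [seq h i.+1 - h i | i <- iota t m])
      = [seq h i.+1 - h i | i <- iota t m] by exact: (gen N.+1).
elim: k m t => // k IHk [|m] t //= lt_mk def_N ht.
have le1 : `|h t.+1 - h t| <= 1 by apply: h1; lia.
case: eqP => [e1|ne1] /=.
  rewrite e1 /slopes /= -[flatten _]/(slopes _) IHk //; lia.
case: eqP => [e1|ne2] /=.
  rewrite e1 /slopes /= -[flatten _]/(slopes _) IHk //; lia.
have flat : h t.+1 = h t by lia.
have [||_ flat2] := hodd t.+1; [lia | lia |].
case: m lt_mk def_N => [|m] lt_mk def_N /=.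
  by move: hN; rewrite -def_N addn1; lia.
rewrite flat2 flat subrr /slopes /= -[flatten _]/(slopes _) IHk //; lia.
Qed.

Definition bottom_word (n : nat) : seq step := nseq n HH.

Lemma bottom_wordP n : is_schroder n (bottom_word n).
Proof.
have h0 t : height (bottom_word n) t = 0.
  by elim: n t => [|n IHn] [|[|t]] //=;
    rewrite ?(height_nil, height0, heightH1, heightH).
rewrite /is_schroder !h0 eqxx /=; apply/andP; split; last first.
  by apply/forallP=> t; rewrite h0.
by apply/eqP; elim: n {h0} => //= n ->.
Qed.

Definition bottom_path n := Schroder (bottom_wordP n).

(* The Schroder path with given heights; junk value if h is not a profile. *)
Definition path_of_height (n : nat) (h : nat -> int) : schroder n :=
  insubd (bottom_path n) (unslopes (increments h n.*2)).

Lemma height_path_of_height n h : profile n h ->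
  forall t, (t <= n.*2)%N -> height (path_of_height n h) t = h t.
Proof.
move=> [h0 h2n h_ge0 h1 hodd].
have slopesE : slopes (unslopes (increments h n.*2)) = increments h n.*2.
  by apply: unslopesK => //; [rewrite h2n; lia | rewrite h0].
have heightE t : (t <= n.*2)%N ->
    height (unslopes (increments h n.*2)) t = h t.
  move=> le_t; rewrite /height slopesE /increments /mkseq -map_take take_iota.
  rewrite (minn_idPl le_t) big_map -{1}[t]subn0 -[iota _ _]/(index_iota 0 t).
  by rewrite telescope_sumr // h0 subr0.
move=> t le_t; rewrite /path_of_height insubdK ?heightE //.
rewrite unfold_in /= /is_schroder slopesE size_mkseq eqxx heightE // h2n eqxx /=.
by apply/forallP => -[i /= lei]; rewrite heightE ?h_ge0.
Qed.

End HeightTheory.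

Section SchroderLattice.
Variable n : nat.
Implicit Types x y z : schroder n.

(* The letters of the word, padded with None to length 2n. *)
Definition schroder_code x : {ffun 'I_n.*2 -> option step} :=
  [ffun i : 'I_n.*2 => onth (word x) i].

Definition schroder_decode (f : {ffun 'I_n.*2 -> option step}) :
  option (schroder n) := insub (pmap id (codom f)).

Lemma size_word x : (size (word x) <= n.*2)%N.
Proof.
case: x => w /= /and3P[/eqP <- _ _].
by elim: w => //= -[] w; rewrite /slopes /=; lia.
Qed.

Lemma schroder_codeK : pcancel schroder_code schroder_decode.
Proof.
move=> x; rewrite /schroder_decode.
suff -> : pmap id (codom (schroder_code x)) = word x by rewrite valK.
rewrite codomE (eq_map (ffunE _)) (map_comp (onth (word x)) val) val_enum_ord.
have := size_word x; elim: (word x) n.*2 => [|s w IHw] m.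
  by move=> _; elim: m 0%N => //= m IHm k; rewrite onth0n IHm.
case: m => //= m; rewrite ltnS => /IHw {2}<-.
by rewrite (iotaDl 1) -map_comp.
Qed.

HB.instance Definition _ :=
  isFinite.Build (schroder n) (pcan_enumP schroder_codeK).

Local Open Scope ring_scope.

Definition schroder_le x y : bool :=
  [forall t : 'I_(n.*2).+1, height x t <= height y t].

Lemma schroder_leP x y :
  reflect (forall t, (t <= n.*2)%N -> height x t <= height y t)
          (schroder_le x y).
Proof.
apply: (iffP forallP) => [le_xy t le_t | le_xy t];
  last by apply: le_xy; rewrite -ltnS ltn_ord.
exact: (le_xy (Ordinal (le_t : (t < (n.*2).+1)%N))).
Qed.

Lemma schroder_eq x y :
  (forall t, (t <= n.*2)%N -> height x t = height y t) -> x = y.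
Proof.
move=> eq_xy; apply/val_inj/(can_inj slopesK) => /=.
have sz (z : schroder n) : size (slopes z) = n.*2.
  by case: z => w /= /and3P[/eqP].
rewrite slopesE [RHS]slopesE !sz; apply/eq_in_map => t; rewrite mem_iota.
by move=> /= lt_t; rewrite !eq_xy // ltnW.
Qed.

Lemma schroder_le_refl : reflexive schroder_le.
Proof. by move=> x; apply/schroder_leP. Qed.

Lemma schroder_le_anti : antisymmetric schroder_le.
Proof.
move=> x y /andP[/schroder_leP le_xy /schroder_leP le_yx].
by apply: schroder_eq => t le_t; apply/le_anti; rewrite le_xy ?le_yx.
Qed.

Lemma schroder_le_trans : transitive schroder_le.
Proof.
move=> y x z /schroder_leP le_xy /schroder_leP le_yz.
by apply/schroder_leP => t le_t; exact: le_trans (le_xy t le_t) (le_yz t le_t).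
Qed.

Fact schroder_display : Order.disp_t. Proof. exact: Order.Disp tt tt. Qed.

HB.instance Definition _ := Order.Le_isPOrder.Build schroder_display
  (schroder n) schroder_le_refl schroder_le_anti schroder_le_trans.

Definition schroder_meet x y : schroder n :=
  path_of_height n (fun t => Num.min (height x t) (height y t)).

Definition schroder_join x y : schroder n :=
  path_of_height n (fun t => Num.max (height x t) (height y t)).

Lemma height_schroder_meet x y t : (t <= n.*2)%N ->
  height (schroder_meet x y) t = Num.min (height x t) (height y t).
Proof.
apply: (height_path_of_height (h := fun t => Num.min _ _)).
have [x0 x2n x_ge0 x1 xodd] := profile_height x.
have [y0 y2n y_ge0 y1 yodd] := profile_height y.
split=> [||{}t le_t|{}t lt_t|{}t le_t odd_t]; rewrite ?(x0, x2n, y0, y2n) //.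
- by have := x_ge0 t le_t; have := y_ge0 t le_t; lia.
- by have := x1 t lt_t; have := y1 t lt_t; lia.
have var w s : `|height w s.+1 - height w s| <= 1 by exact: height_step.
have [xt yt] := (xodd t le_t, yodd t le_t).
case: t => [|t] in le_t odd_t xt yt *; first by rewrite x0 y0 in odd_t.
have := var x t; have := var y t; have := var x t.+1; have := var y t.+1.
by move: xt yt odd_t => /=; lia.
Qed.

Lemma height_schroder_join x y t : (t <= n.*2)%N ->
  height (schroder_join x y) t = Num.max (height x t) (height y t).
Proof.
apply: (height_path_of_height (h := fun t => Num.max _ _)).
have [x0 x2n x_ge0 x1 xodd] := profile_height x.
have [y0 y2n y_ge0 y1 yodd] := profile_height y.
split=> [||{}t le_t|{}t lt_t|{}t le_t odd_t]; rewrite ?(x0, x2n, y0, y2n) //.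
- by have := x_ge0 t le_t; have := y_ge0 t le_t; lia.
- by have := x1 t lt_t; have := y1 t lt_t; lia.
have var w s : `|height w s.+1 - height w s| <= 1 by exact: height_step.
have [xt yt] := (xodd t le_t, yodd t le_t).
case: t => [|t] in le_t odd_t xt yt *; first by rewrite x0 y0 in odd_t.
have := var x t; have := var y t; have := var x t.+1; have := var y t.+1.
by move: xt yt odd_t => /=; lia.
Qed.

Lemma schroder_meetP x y z :
  (x <= schroder_meet y z)%O = (x <= y)%O && (x <= z)%O.
Proof.
apply/schroder_leP/andP => [le_x | [/schroder_leP le_y /schroder_leP le_z] t].
  by split; apply/schroder_leP => t le_t; have := le_x t le_t;
    rewrite height_schroder_meet // le_min => /andP[].
by move=> le_t; rewrite height_schroder_meet // le_min le_y ?le_z.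
Qed.

Lemma schroder_joinP x y z :
  (schroder_join x y <= z)%O = (x <= z)%O && (y <= z)%O.
Proof.
apply/schroder_leP/andP => [le_z | [/schroder_leP le_x /schroder_leP le_y] t].
  by split; apply/schroder_leP => t le_t; have := le_z t le_t;
    rewrite height_schroder_join // ge_max => /andP[].
by move=> le_t; rewrite height_schroder_join // ge_max le_x ?le_y.
Qed.

HB.instance Definition _ := Order.POrder_MeetJoin_isLattice.Build
  schroder_display (schroder n) schroder_meetP schroder_joinP.

Lemma schroder_meetUl :
  @left_distributive (schroder n) (schroder n) Order.meet Order.join.
Proof.
move=> x y z; rewrite -[LHS]/(schroder_meet (schroder_join x y) z).
rewrite -[RHS]/(schroder_join (schroder_meet x z) (schroder_meet y z)).
apply: schroder_eq => t le_t.
rewrite height_schroder_meet // !height_schroder_join // !height_schroder_meet //.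
by lia.
Qed.

HB.instance Definition _ := Order.Lattice_Meet_isDistrLattice.Build
  schroder_display (schroder n) schroder_meetUl.

Lemma schroder_le0x x : (bottom_path n <= x)%O.
Proof.
have [_ _ x_ge0 _ _] := profile_height x.
apply/schroder_leP => t /x_ge0; apply: le_trans => /=; clear.
by elim: n t => [|m IHm] [|[|t]] //=;
  rewrite ?(height_nil, height0, heightH1, heightH).
Qed.

HB.instance Definition _ := Order.hasBottom.Build
  schroder_display (schroder n) schroder_le0x.

Definition top_path : schroder n :=
  path_of_height n (fun t => (minn t (n.*2 - t))%:Z).

Lemma schroder_lex1 x : (x <= top_path)%O.
Proof.
have [x0 x2n x_ge0 x1 _] := profile_height x.
apply/schroder_leP => t le_t.
rewrite (height_path_of_height (h := fun t => (minn t (n.*2 - t))%:Z)) //;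
  last by split=> *; lia.
have le_left : height x t <= t%:Z.
  elim: t le_t => [|t IHt] le_t; first by rewrite x0.
  by have := x1 t le_t; have := IHt (ltnW le_t); lia.
suff: forall k, (k <= n.*2)%N -> height x (n.*2 - k) <= k%:Z.
  by move/(_ (n.*2 - t)%N (leq_subr _ _)); rewrite subKn //; lia.
elim=> [|k IHk] le_k; first by rewrite subn0 x2n.
have := IHk (ltnW le_k); have := x1 (n.*2 - k.+1)%N.
have -> : ((n.*2 - k.+1).+1 = n.*2 - k)%N by lia.
by lia.
Qed.

HB.instance Definition _ := Order.hasTop.Build
  schroder_display (schroder n) schroder_lex1.

End SchroderLattice.

Definition schroder_lattice (n : nat) : finTBDistrLatticeType schroder_display :=
  schroder n.

Definition peak_word (n i j : nat) : seq step :=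
  nseq i HH ++ nseq (j - i) U ++ nseq (j - i) D ++ nseq (n - j) HH.

Definition truncated_word (n i j : nat) : seq step :=
  nseq i HH ++ nseq (j - i - 1) U ++ [:: HH] ++ nseq (j - i - 1) D
    ++ nseq (n - j) HH.

(* 'I_m.+1 stands for the chain C_m. The subtraction is that of nat, which agrees with that of int here because
   the left-hand side is positive. *)
Record triple (n : nat) := Triple {
  triple_val :> 'I_n.+1 * 'I_n.+1 * 'I_2;
  tripleP : let: (i, j, k) := triple_val in 2 + 2 * k <= 2 * j - 2 * i }.

HB.instance Definition _ n := [isSub for @triple_val n].
HB.instance Definition _ n := [Finite of triple n by <:].

Section TripleOrder.
Variable n : nat.
Implicit Types t u : triple n.

(* As i < j in every triple, inclusions between these sets of integers are those
   between the real intervals [i,j]. *)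
Definition interval_set (i j : 'I_n.+1) : {set 'I_n.+1} :=
  [set m : 'I_n.+1 | i <= m <= j].

Definition triple_le t u : bool :=
  let: (i, j, k) := triple_val t in
  let: (i', j', k') := triple_val u in
  (interval_set i j \proper interval_set i' j')
  || ((i, j) == (i', j')) && (k' <= k).

Lemma triple_le_refl : reflexive triple_le.
Proof. by case=> -[[i j] k] /= p; rewrite /triple_le /= eqxx leqnn orbT. Qed.

Lemma triple_le_anti : antisymmetric triple_le.
Proof.
move=> [[[i j] k] p] [[[i' j'] k'] p']; rewrite /triple_le /= => /andP[le1 le2].
apply/val_inj => /=; case/orP: le1 => [lt1|/andP[/eqP[? ?] le1]]; last first.
  by subst; move: le2; rewrite properxx eqxx /= => le2;
    congr (_, _, _); apply/val_inj/eqP; rewrite eqn_leq le1 le2.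
case/orP: le2 => [lt2|/andP[/eqP[? ?] _]]; last by subst; rewrite properxx in lt1.
by have := proper_trans lt1 lt2; rewrite properxx.
Qed.

Lemma triple_le_trans : transitive triple_le.
Proof.
move=> [[[i j] k] p] [[[i' j'] k'] p'] [[[i'' j''] k''] p''].
rewrite /triple_le /=.
case/orP=> [lt1|/andP[/eqP[-> ->] le1]]; case/orP=> [lt2|/andP[/eqP[<- <-] le2]].
- by rewrite (proper_trans lt1 lt2).
- by rewrite lt1.
- by rewrite lt2.
- by rewrite eqxx (leq_trans le2 le1) orbT.
Qed.

Fact triple_display : Order.disp_t. Proof. exact: Order.Disp tt tt. Qed.

HB.instance Definition _ := Order.Le_isPOrder.Build triple_display
  (triple n) triple_le_refl triple_le_anti triple_le_trans.

Definition triple_word t : seq step :=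
  let: (i, j, k) := triple_val t in
  if k == ord0 then peak_word n i j else truncated_word n i j.

End TripleOrder.

(* Main.v *)
Require Import Defs.
From mathcomp Require Import all_boot all_order all_algebra.
From mathcomp Require Import zify.

(** The two families are the cases k = 0 and k = 1 of a pyramid over [2i, 2j]
    cut at height j - i - k. As paths are 1-Lipschitz and the points (t, h t)
    with t + h t odd are midpoints of flat steps, such a pyramid lies below a
    path x as soon as x has height at least j - i - k at the midpoint i + j.
    This condition is prime for joins, which are pointwise maxima, so pyramids
    are join-irreducible; and through each point of x of positive height passes
    the top of a pyramid below x, so x is a join of pyramids. Comparing two
    pyramids at a midpoint gives the order of the spectrum. *)

Set Implicit Arguments.
Unset Strict Implicit.
Unset Printing Implicit Defensive.

Import Order.TTheory GRing.Theory Num.Theory.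

(** * Join-irreducible elements of a finite lattice *)

Section JoinIrreducible.
Context {d : Order.disp_t} {L : finTBLatticeType d}.
Implicit Types x u v : L.
Local Open Scope order_scope.

Lemma join_irreducibleP x :
  reflect (x != \bot /\ forall u v, x = u `|` v -> x = u \/ x = v)
          (join_irreducible x).
Proof.
apply: (iffP andP) => -[x_neq0 irr]; split=> //.
  move=> u v /eqP def_x.
  by move/forallP/(_ u)/forallP/(_ v)/implyP/(_ def_x): irr
    => /orP[] /eqP; [left | right].
apply/forallP => u; apply/forallP => v; apply/implyP => /eqP/irr[] /eqP -> //.
exact: orbT.
Qed.

Lemma join_prime_irreducible x :
  x != \bot -> (forall u v, x <= u `|` v -> x <= u \/ x <= v) ->
  join_irreducible x.
Proof.
move=> x_neq0 prime_x; apply/join_irreducibleP; split=> // u v def_x.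
have [|le_x|le_x] := prime_x u v; first by rewrite -def_x.
  by left; apply/le_anti; rewrite le_x def_x leUl.
by right; apply/le_anti; rewrite le_x def_x leUr.
Qed.

(** The elements strictly below a join-irreducible [x] include [\bot] and are closed under binary
    joins, so a finite join of such elements cannot reach [x]. *)
Lemma join_irreducible_bigjoin (I : finType) (P : pred I) (F : I -> L) x :
  join_irreducible x -> x = \join_(i | P i) F i ->
  exists2 i, P i & x = F i.
Proof.
move=> /join_irreducibleP[x_neq0 irr] def_x.
have le_x i : P i -> F i <= x by move=> Pi; rewrite def_x joins_sup.
have [/exists_inP[i Pi /eqP]|no_i] := boolP [exists (i | P i), x == F i].
  by exists i.
suff: \join_(i | P i) F i < x by rewrite -def_x ltxx.
elim/big_ind: _ => [|u v lt_u lt_v|i Pi]; first by rewrite lt0x.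
  rewrite lt_neqAle leUx (ltW lt_u) (ltW lt_v) !andbT; apply/eqP => /esym/irr.
  by case=> eq_x; rewrite eq_x ltxx in lt_u lt_v.
rewrite lt_neqAle le_x // andbT eq_sym.
by move: no_i; rewrite negb_exists_in => /forall_inP/(_ i Pi).
Qed.

End JoinIrreducible.

(** * Heights of pyramids *)

Section Pyramid.
Local Open Scope ring_scope.

(** Truncated subtraction also covers the abscissae inside the block: there the tail [w] contributes
    [height w 0 = 0]. *)
Lemma height_nseqH a w t : height (nseq a HH ++ w) t = height w (t - a.*2)%N.
Proof.
elim: a t => [|a IHa] [|[|t]]; rewrite ?subn0 ?height0 //=.
  by rewrite heightH1.
by rewrite heightH IHa.
Qed.

Lemma height_nseqU a w t :
  height (nseq a U ++ w) t = (minn t a)%:Z + height w (t - a)%N.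
Proof.
elim: a t => [|a IHa] [|t]; rewrite ?subn0 ?minn0 ?min0n ?height0 ?add0r //=.
by rewrite heightU IHa subSS minnSS; lia.
Qed.

Lemma height_nseqD a w t :
  height (nseq a D ++ w) t = - (minn t a)%:Z + height w (t - a)%N.
Proof.
elim: a t => [|a IHa] [|t]; rewrite ?subn0 ?minn0 ?min0n ?height0 ?add0r //=.
by rewrite heightD IHa subSS minnSS; lia.
Qed.

Definition pyramid_word (n i j k : nat) : seq step :=
  nseq i HH ++ nseq (j - i - k) U ++ nseq k HH ++ nseq (j - i - k) D
    ++ nseq (n - j) HH.

Lemma pyramid_word0 n i j : pyramid_word n i j 0 = peak_word n i j.
Proof. by rewrite /pyramid_word subn0. Qed.

Lemma pyramid_word1 n i j : pyramid_word n i j 1 = truncated_word n i j.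
Proof. by []. Qed.

(** The sides lie on the lines of slope 1 and -1 through [(2i,0)] and [(2j,0)]; the top, of length
    [2k], is centred at [i + j]. This closed form reduces questions on pyramids to linear
    arithmetic. *)
Lemma height_pyramid_word n i j k t : (i + k < j)%N ->
  height (pyramid_word n i j k) t =
    Num.max 0 (Num.min (j - i - k)%N%:Z
                 (Num.min (t%:Z - i.*2%:Z) (j.*2%:Z - t%:Z))).
Proof.
move=> lt_ij; rewrite /pyramid_word height_nseqH height_nseqU height_nseqH.
rewrite height_nseqD -[nseq (n - j) HH]cats0 height_nseqH height_nil; lia.
Qed.

Lemma pyramid_wordP n i j k :
  (i + k < j)%N -> (j <= n)%N -> is_schroder n (pyramid_word n i j k).
Proof.
move=> lt_ij le_jn; apply/and3P; split.
- have sz_nseq a s : size (slopes (nseq a s)) = (a * size (step_slopes s))%N.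
    by rewrite /slopes map_nseq size_flatten /shape map_nseq sumn_nseq mulnC.
  have sz_cat w1 w2 :
      size (slopes (w1 ++ w2)) = (size (slopes w1) + size (slopes w2))%N.
    by rewrite /slopes map_cat flatten_cat size_cat.
  by rewrite /pyramid_word !sz_cat !sz_nseq /=; lia.
- by rewrite height_pyramid_word //; lia.
- by apply/forallP => t; rewrite height_pyramid_word //; lia.
Qed.

Lemma height_dist w s t : `|height w s - height w t| <= `|s%:Z - t%:Z|.
Proof.
wlog le_ts : s t / (t <= s)%N => [hw|].
  by case/orP: (leq_total t s) => /hw //; rewrite distrC [X in _ <= X]distrC.
rewrite -(subnK le_ts); elim: (s - t)%N => [|m IHm]; first by rewrite subrr.
by have := height_step w (m + t); rewrite addSn; lia.
Qed.

(** * Pyramids in the Schröder lattice *)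

Section Lattice.
Variable n : nat.
Implicit Types (x y : schroder_lattice n) (i j k : nat).

Lemma height_join x y t : (t <= n.*2)%N ->
  height (word (x `|` y)%O) t = Num.max (height (word x) t) (height (word y) t).
Proof. exact: height_schroder_join. Qed.

Lemma height_bottom t : height (word (\bot%O : schroder_lattice n)) t = 0.
Proof.
rewrite -[word _]/(nseq n HH) -[nseq n HH]cats0.
by rewrite height_nseqH height_nil.
Qed.

Lemma pyramid_le x y i j k :
  (i + k < j)%N -> (j <= n)%N -> (k <= 1)%N -> word x = pyramid_word n i j k ->
  (x <= y)%O = ((j - i - k)%N%:Z <= height (word y) (i + j)).
Proof.
move=> lt_ij le_jn le_k1 def_x.
have [_ _ y_ge0 _ y_odd] := profile_height y.
apply/(@schroder_leP n)/idP => [/(_ (i + j)%N)|le_y t le_t].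
  by rewrite def_x height_pyramid_word //; lia.
have le_ij : (i + j <= n.*2)%N by lia.
(* For [k = 1] the Lipschitz bound from [i + j] falls short by one when [y] has height exactly
   [j - i - 1] there. Then [(i + j) + (j - i - 1)] is odd, so [y] has the same height at both
   neighbours, and the bound from the neighbour nearer to [t] suffices. *)
have := y_odd (i + j)%N le_ij; have := y_ge0 t le_t.
have := height_dist (word y) t (i + j); have := height_dist (word y) t (i + j).+1.
have := height_dist (word y) t (i + j).-1.
rewrite def_x height_pyramid_word //.
by case: (ltngtP t (i + j)) => [||->]; lia.
Qed.

Lemma pyramid_irreducible x i j k :
  (i + k < j)%N -> (j <= n)%N -> (k <= 1)%N -> word x = pyramid_word n i j k ->
  join_irreducible x.
Proof.
move=> lt_ij le_jn le_k1 def_x; apply: join_prime_irreducible => [|u v].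
  (* By the midpoint criterion, lying below [\bot] would mean [j - i - k <= 0]. *)
  by rewrite -lex0 (pyramid_le _ lt_ij le_jn le_k1 def_x) height_bottom; lia.
rewrite !(pyramid_le _ lt_ij le_jn le_k1 def_x) height_join; last lia.
by rewrite le_max => /orP.
Qed.

Lemma pyramid_through x s : (s <= n.*2)%N -> 0 < height (word x) s ->
  exists y, [/\ (y <= x)%O, height (word y) s = height (word x) s
    & exists i j k, [/\ (i + k < j)%N, (j <= n)%N, (k <= 1)%N
                      & word y = pyramid_word n i j k]].
Proof.
move=> le_s x_gt0; have [x0 x2n _ _ x_odd] := profile_height x.
have ds := height_dist (word x) s 0; have de := height_dist (word x) s n.*2.
rewrite height0 in ds; rewrite x2n in de.
have {x_odd} [h def_h] : exists h : nat, height (word x) s = h%:Z.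
  by exists `|height (word x) s|%N; lia.
have [i [j [k [lt_ij le_jn le_k1 def_s def_c]]]] : exists i j k, [/\
    (i + k < j)%N, (j <= n)%N, (k <= 1)%N, (i + j)%N = s & (j - i - k)%N = h].
  (* Solving [i + j = s] and [j - i - k = h] gives [2j = s + h + k] and [2i = s - h - k], so [k]
     must be the parity of [s + h]. The bounds [ds] and [de] give [h <= s] and [s + h <= 2n]. *)
  exists (s - h)./2, (uphalf (s + h)), (odd (s + h) : nat).
  by split; lia.
pose y : schroder_lattice n := Schroder (pyramid_wordP lt_ij le_jn).
exists y; split; last by exists i, j, k.
  by rewrite (@pyramid_le y x i j k) // def_s def_h def_c.
by rewrite height_pyramid_word //; lia.
Qed.

Lemma irreducible_pyramid x : join_irreducible x ->
  exists i j k, [/\ (i + k < j)%N, (j <= n)%N, (k <= 1)%N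
                  & word x = pyramid_word n i j k].
Proof.
move=> irr_x.
(* Bounding the indices makes this a boolean predicate, fit to index a [\join]. *)
pose is_pyramid y := [exists i : 'I_n.+1, exists j : 'I_n.+1, exists k : 'I_2,
  [&& (i + k < j)%N & word y == pyramid_word n i j k]].
have def_x : x = (\join_(y | is_pyramid y && (y <= x)%O) y)%O.
  apply/le_anti/andP; split; last by apply/joinsP => y /andP[].
  apply/(@schroder_leP n) => s le_s.
  set z := (\join_(y | _) _)%O.
  have [_ _ z_ge0 _ _] := profile_height z.
  have [x_gt0|x_le0] := ltP 0 (height (word x) s); last first.
    exact: le_trans x_le0 (z_ge0 s le_s).
  have [y [le_yx <- [i [j [k [lt_ij le_jn le_k1 def_y]]]]]] :=
    pyramid_through le_s x_gt0.
  suff /(@schroder_leP n) : (y <= z)%O by apply.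
  have lt_i : (i < n.+1)%N by lia.
  have lt_j : (j < n.+1)%N by lia.
  have lt_k : (k < 2)%N by lia.
  apply: joins_sup; rewrite le_yx andbT; apply/existsP; exists (Ordinal lt_i).
  apply/existsP; exists (Ordinal lt_j); apply/existsP; exists (Ordinal lt_k).
  by rewrite /= lt_ij def_y eqxx.
have [y /andP[pyr_y _] ->] := join_irreducible_bigjoin irr_x def_x.
have /existsP[i /existsP[j /existsP[k /andP[lt_ij /eqP def_y]]]] := pyr_y.
exists i, j, k; split=> //.
  by have := ltn_ord j; lia.
by have := ltn_ord k; lia.
Qed.

End Lattice.
End Pyramid.

(** * Triples and the order of the spectrum *)

(** Since [i <= j], both endpoints belong to the first set, and inclusion can be tested on them. *)
Lemma interval_set_subset n (i j i' j' : 'I_n.+1) : i <= j ->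
  (interval_set i j \subset interval_set i' j') = (i' <= i) && (j <= j').
Proof.
move=> le_ij; apply/subsetP/andP => [sub|[le_i le_j] m]; last first.
  by rewrite !inE; lia.
by have := sub i; have := sub j; rewrite !inE; lia.
Qed.

Lemma triple_wordE n (t : triple n) :
  triple_word t =
    let: (i, j, k) := triple_val t in pyramid_word n i j k.
Proof.
case: t => -[[i j] k] p; rewrite /triple_word /=.
have [->|k_neq0] := eqVneq k ord0; first by rewrite pyramid_word0.
have -> : val k = 1; last by rewrite pyramid_word1.
by case: k k_neq0 {p} => -[|[|k]].
Qed.

(** A sigma type, so that the isomorphism can be defined by projection. *)
Lemma triple_word_irreducible n (t : triple n) :
  {x : Spec (schroder_lattice n) | word (val x) = triple_word t}.
Proof.
rewrite triple_wordE; case: t => -[[i j] k] /= p.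
have lt_ij : i + k < j by lia.
have le_jn : j <= n by rewrite -ltnS.
have le_k1 : k <= 1 by rewrite -ltnS.
have irr := pyramid_irreducible lt_ij le_jn le_k1
  (erefl (word (Schroder (pyramid_wordP lt_ij le_jn)))).
by exists (Sub _ irr).
Qed.

Theorem proposition5p1 (n : nat) :
  (forall w : seq step,
     (exists2 x : schroder_lattice n, join_irreducible x & word x = w) <->
     (exists i j : nat, i + 1 <= j <= n /\ w = peak_word n i j) \/
     (exists i j : nat, i + 2 <= j <= n /\ w = truncated_word n i j))
  /\
  (exists f : triple n -> Spec (schroder_lattice n),
     [/\ bijective f,
         {mono f : t u / (t <= u)%O}
       & forall t : triple n, word (val (f t)) = triple_word t]).
Proof.
split=> [w|].
  split=> [[x /irreducible_pyramid[i [j [k [lt_ij le_jn le_k1 def_x]]]] <-]|].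
    case: k le_k1 lt_ij def_x => [|[|//]] _ lt_ij ->; [left | right];
      exists i, j; rewrite ?pyramid_word0 ?pyramid_word1; split=> //; lia.
  have irr i j k : i + k < j -> j <= n -> k <= 1 ->
      exists2 x : schroder_lattice n, join_irreducible x
        & word x = pyramid_word n i j k.
    move=> lt_ij le_jn le_k1; exists (Schroder (pyramid_wordP lt_ij le_jn)) => //.
    exact: (pyramid_irreducible lt_ij le_jn le_k1).
  case=> -[i [j [/andP[lt_ij le_jn] ->]]].
    by rewrite -pyramid_word0; apply: irr; lia.
  by rewrite -pyramid_word1; apply: irr; lia.
pose f t := sval (@triple_word_irreducible n t).
have fE t : word (val (f t)) = triple_word t.
  by rewrite /f; case: (triple_word_irreducible t).
have f_mono : {mono f : t u / (t <= u)%O}.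
  move=> t u; rewrite leEsub.
  have := fE u; have := fE t; rewrite !triple_wordE.
  move: (f t) (f u) => x y; rewrite -[(t <= u)%O]/(triple_le t u) /triple_le.
  case: t u => -[[i j] k] /= p [[[i' j'] k'] /= p'] def_x def_y.
  have [[[lt_j lt_j'] lt_k] lt_k'] :=
    (ltn_ord j, ltn_ord j', ltn_ord k, ltn_ord k').
  (* The criterion becomes [2i' <= 2i + k], [2j - k <= 2j'] and [j - i - k <= j' - i' - k']. As
     [k <= 1], the first two say [i' <= i] and [j <= j']. The third then holds if the inclusion is
     strict, because [k' <= 1], and otherwise says [k' <= k]. *)
  rewrite (pyramid_le _ _ _ _ def_x); [|lia..].
  rewrite def_y height_pyramid_word; last lia.
  rewrite properE !interval_set_subset; [|lia..].
  rewrite xpair_eqE -!val_eqE /=; lia.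
exists f; split=> //.
have f_inj : injective f by apply: inc_inj.
(* The boolean [==] lets [xchoose] extract an inverse function. *)
have f_surj x : exists t, f t == x.
  have [i [j [k [lt_ij le_jn le_k1 def_x]]]] := irreducible_pyramid (valP x).
  have lt_i : i < n.+1 by lia.
  have lt_j : j < n.+1 by lia.
  have lt_k : k < 2 by lia.
  have p : 2 + 2 * Ordinal lt_k <= 2 * Ordinal lt_j - 2 * Ordinal lt_i.
    by rewrite /=; lia.
  exists (@Triple n (Ordinal lt_i, Ordinal lt_j, Ordinal lt_k) p).
  by rewrite -!val_eqE /= fE triple_wordE def_x.
by exists (fun x => xchoose (f_surj x)) => [t|x]; [apply: f_inj|];
  apply/eqP; exact: xchooseP (f_surj _).
Qed.
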